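(* Let $n\ge 1$ and let $\sigma,\tau\in S^B_n$. Let $J(\sigma,\tau)\in S^B_n$ be the signed permutation produced from $\sigma$ and $\tau$ by the algorithm described in the context. Then $$J(\sigma,\tau)=\sigma\vee_R\tau,$$ where $\sigma\vee_R\tau$ denotes the join of $\sigma$ and $\tau$ in the (right) weak order $(S^B_n,\leq_R)$.
   Context: **Signed permutations.** Write $[n]=\{1,\ldots,n\}$, $[\pm n]=\{-n,\ldots,-1,1,\ldots,n\}$ and $\overline{i}=-i$. $S^B_n$ is the group (under composition of maps) of bijections $\sigma:[\pm n]\to[\pm n]$ with $\sigma(-a)=-\sigma(a)$ for all $a\in[n]$. It is a Coxeter group of type $B_n$ with Coxeter generators $s_0,s_1,\ldots,s_{n-1}$, where $s_0$ exchanges $1$ and $\overline 1$ (fixing everything else) and, for $1\le i\le n-1$, $s_i$ exchanges $i$ with $i+1$ and $\overline{i}$ with $\overline{i+1}$ (fixing everything else). The complete notation of $\sigma$ is the string $\sigma(\overline n)\cdots\sigma(\overline 1)\sigma(1)\cdots\sigma(n)$ of length $2n$. **Weak order.** Let $\ell$ be the Coxeter length. For $u,v\in S^B_n$, $u\leq_R v$ if and only if some reduced expression for $u$ is a prefix of a reduced expression for $v$ (equivalently, $v=uw$ for some $w$ with $\ell(v)=\ell(u)+\ell(w)$). Since the group is finite, $(S^B_n,\leq_R)$ is a lattice. **Algorithm.** For $\sigma\in S^B_n$ and $2\le i\le n$ define $$H^\sigma_i=\{a\in[\pm(i-1)]\mid \sigma^{-1}(a)>\sigma^{-1}(i)\}.$$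 Given $\sigma,\tau\in S^B_n$, define signed permutations $\pi_i\in S^B_i$ for $i=1,\ldots,n$, always written in complete notation (as strings of length $2i$), as follows. 1. $\pi_1=\overline{1}\,1$ if $\sigma^{-1}(1)>0$ and $\tau^{-1}(1)>0$; otherwise $\pi_1=1\,\overline{1}$. 2. For each $i=2,3,\ldots,n$: let $C^*_{i-1}$ be the shortest (possibly empty) suffix of the string $\pi_{i-1}$ whose set of entries contains $H^\sigma_i\cup H^\tau_i$, and let $C_{i-1}$ be the string with $\pi_{i-1}=C_{i-1}C^*_{i-1}$ (concatenation). Denote by $|\cdot|$ the length of a string. Then $\pi_i$ is obtained by inserting $i$ and $\overline{i}$ in $\pi_{i-1}$ as follows: - if $|C^*_{i-1}|\geq i$, then $\pi_i=C_{i-1}\; i\; C^{*'}_{i-1}\;\overline{i}\; C^{*''}_{i-1}$, where $C^*_{i-1}=C^{*'}_{i-1}C^{*''}_{i-1}$ with $|C^{*''}_{i-1}|=|C_{i-1}|$; - if $|C^*_{i-1}|\leq i-2$, then $\pi_i=C'_{i-1}\;\overline{i}\; C''_{i-1}\; i\; C^*_{i-1}$, where $C_{i-1}=C'_{i-1}C''_{i-1}$ with $|C'_{i-1}|=|C^*_{i-1}|$; - if $|C^*_{i-1}|=i-1$ and both $\sigma^{-1}(i)>0$ and $\tau^{-1}(i)>0$, then $\pi_i=C_{i-1}\;\overline{i}\; i\; C^*_{i-1}$; - if $|C^*_{i-1}|=i-1$ and at least one of $\sigma^{-1}(i),\tau^{-1}(i)$ is negative, then $\pi_i=C_{i-1}\;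 i\;\overline{i}\; C^*_{i-1}$. 3. Set $J(\sigma,\tau):=\pi_n$. *)

(* Defs.v *)
From HB Require Import structures.
From mathcomp Require Import all_boot all_order all_fingroup all_algebra.

Set Implicit Arguments.
Unset Strict Implicit.
Unset Printing Implicit Defensive.

Import Order.TTheory GRing.Theory Num.Theory GroupScope.

(* The set [±n] = {-n, .., -1, 1, .., n} is encoded by pairs
   of a sign (true = negative) and an ordinal k < n standing for the absolute
   value k + 1; pm_val gives back the integer. *)
Notation pm n := (bool * 'I_n)%type.

Section SignedPermutations.

Variable n : nat.
Implicit Types (a : pm n) (k : 'I_n) (u v : {perm pm n}) (w : seq 'I_n).

Definition pos k : pm n := (false, k).
Definition neg k : pm n := (true, k).
Definition opp a : pm n := (~~ a.1, a.2).

Definition pm_val a : int := ((-1) ^+ a.1 * (a.2.+1)%:Z)%R.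

Definition SB : {set {perm pm n}} :=
  [set s : {perm pm n} | [forall k, s (neg k) == opp (s (pos k))]].

Lemma SBP (s : {perm pm n}) :
  reflect (forall a, s (opp a) = opp (s a)) (s \in SB).
Proof.
rewrite inE; apply: (iffP forallP) => [sN [[] k] | sN k]; last first.
- by apply/eqP; rewrite -sN.
- exact/eqP/sN.
- by have /eqP := sN k; rewrite /neg => ->; rewrite /opp /= negbK; case: (s _).
Qed.

Lemma SB_group_set : group_set SB.
Proof.
apply/group_setP; split=> [|s t /SBP sN /SBP tN].
  by apply/SBP => a; rewrite !perm1.
by apply/SBP => a; rewrite !permM sN tN.
Qed.
Canonical SB_group := Group SB_group_set.

Definition complete (s : {perm pm n}) : seq int :=
  [seq pm_val (s (neg k)) | k <- rev (enum 'I_n)] ++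
  [seq pm_val (s (pos k)) | k <- enum 'I_n].

Definition ord_prev k : 'I_n :=
  Ordinal (leq_ltn_trans (leq_pred k) (ltn_ord k)).

(* As k encodes the absolute value k + 1, the generator s_i (i > 0), which
   exchanges i and i + 1, exchanges the ordinals i - 1 and i. *)
Definition cox_gen (i : 'I_n) : {perm pm n} :=
  if i == 0 :> nat then tperm (pos i) (neg i)
  else tperm (pos (ord_prev i)) (pos i) * tperm (neg (ord_prev i)) (neg i).

(* In MathComp (s * t) x = t (s x), so the composite of maps
   s_(i1) \o ... \o s_(ir) is the product of the reversed word. *)
Definition word_prod w : {perm pm n} := \prod_(i <- rev w) cox_gen i.

Definition reduced_expr u w : Prop :=
  word_prod w = u /\ (forall w', word_prod w' = u -> size w <= size w').

Definition leR u v : Prop :=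
  exists w w', [/\ reduced_expr u w, reduced_expr v w' & prefix w w'].

Definition is_joinR (s t j : {perm pm n}) : Prop :=
  [/\ j \in SB, leR s j, leR t j &
      forall v, v \in SB -> leR s v -> leR t v -> leR j v].

Lemma leR_anti u v : leR u v -> leR v u -> u = v.
Proof.
case=> [w1 [w1' [[w1u w1m] [w1v w1vm] /prefixP[x def1]]]].
case=> [w2 [w2' [[w2v w2m] [w2u w2um] /prefixP[y def2]]]].
have le1 := w1vm _ w2v; have le2 := w2um _ w1u.
rewrite def1 def2 !size_cat in le1 le2.
suff x0 : x = [::] by rewrite -w1u -w1v def1 x0 cats0.
apply/eqP; rewrite -size_eq0 -leqn0 -(leq_add2l (size w1)) addn0.
exact: leq_trans le1 (leq_trans (leq_addr _ _) le2).
Qed.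

Lemma is_joinR_uniq s t j j' : is_joinR s t j -> is_joinR s t j' -> j = j'.
Proof.
move=> [jS sj tj jm] [j'S sj' tj' j'm].
by apply: leR_anti; [apply: jm | apply: j'm].
Qed.

(* H^s_i for the letter i = k + 1. *)
Definition Hset (s : {perm pm n}) k : {set pm n} :=
  [set a | (`|pm_val a| <= k)%N &&
           (pm_val (s^-1%g (pos k)) < pm_val (s^-1%g a))%R].

(* The length of the shortest suffix of p whose entries include those of H:
   find returns the least such m. *)
Definition suffix_len (H : {set pm n}) (p : seq int) : nat :=
  find (fun m => [forall a in H, pm_val a \in drop (size p - m) p])
       (iota 0 (size p).+1).

(* pos_st is the condition s^-1(i) > 0 and t^-1(i) > 0; in the last two cases
   the length of Cs is i - 1. *)
Definition insert_letter (i : nat) (H : {set pm n}) (pos_st : bool)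
    (p : seq int) : seq int :=
  let m := suffix_len H p in
  let C := take (size p - m) p in
  let Cs := drop (size p - m) p in
  if i <= size Cs then
    let d := size Cs - size C in
    C ++ [:: i%:Z%R] ++ take d Cs ++ [:: (- i%:Z)%R] ++ drop d Cs
  else if size Cs <= i - 2 then
    take (size Cs) C ++ [:: (- i%:Z)%R] ++ drop (size Cs) C ++ [:: i%:Z%R] ++ Cs
  else if pos_st then C ++ [:: (- i%:Z)%R; i%:Z%R] ++ Cs
  else C ++ [:: i%:Z%R; (- i%:Z)%R] ++ Cs.

(* Passes from pi_k to pi_(k + 1); the argument p is unused when k = 0. *)
Definition join_step (s t : {perm pm n}) (p : seq int) k : seq int :=
  let pos_st :=
    (0 < pm_val (s^-1%g (pos k)))%R && (0 < pm_val (t^-1%g (pos k)))%R in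
  if k == 0 :> nat then
    if pos_st then [:: -1; 1]%R else [:: 1; -1]%R
  else insert_letter k.+1 (Hset s k :|: Hset t k) pos_st p.

Definition join_string (s t : {perm pm n}) : seq int :=
  foldl (join_step s t) [::] (enum 'I_n).

End SignedPermutations.

(* Main.v *)
Require Import Defs.
From HB Require Import structures.
From mathcomp Require Import all_boot all_order all_fingroup all_algebra.
From mathcomp Require Import zify.
Import Defs.

Set Implicit Arguments.
Unset Strict Implicit.
Unset Printing Implicit Defensive.

Import Order.TTheory GRing.Theory Num.Theory GroupScope.

(** Call (a, b) with a < b an inversion of u when b comes before a in the complete
notation of u.  Inversions come in mirror pairs, (a, b) with (-b, -a).

The weak order is inclusion of inversion sets ([leRP]).  Passing from u to
u \o s_i at an ascent adds exactly one mirror orbit of inversions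
([inverted_ascent]), so the length is the number of mirror orbits of inversions.
If the inversions of u lie among those of v and u differs from v, then some
adjacent positions carry letters that are inverted in v and not in u, so one can
climb from u by such generators until v is reached ([inverted_sub_word]).

It remains to show that the strings pi_k built by the algorithm satisfy, by
induction on k and for the letters of absolute value at most k ([join_inv]): every
inversion of sigma or tau is inverted in pi_k, and every pair inverted in pi_k is
an inversion of each upper bound v of sigma and tau.  At letter i, let H be the set
of the letters of absolute value less than i that follow i in sigma or in tau, and
let pi_(i-1) = C Cs, where Cs is the shortest suffix containing H.  The string
C i Cs is what pi_i becomes once -i is erased, and pi_i is centrally symmetric; so
only the pairs (a, i) and the pair (-i, i) have to be examined.

For (a, i), the letters that follow i are those of Cs, which contains H; conversely
all letters of Cs follow i in every upper bound ([suffix_upper]), because Cs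
starts with a letter c of H.  Indeed let a be a later letter of Cs.  If a < c, then
(a, c) is inverted in pi_(i-1), hence in v, and c follows i in v.  If c < a, then
(c, a) is not inverted in pi_(i-1), hence not in sigma or tau; so a follows c, which
follows i, in the one of them that puts c in H, and a lies in H as well.

For (-i, i): if sigma or tau puts i in the negative half, then H contains one of
each two opposite letters, so Cs has length at least i - 1 ([suffix_size]) and i is
put before -i.  If Cs has length at least i, it contains two opposite letters
([exists_opposite]); both follow i in every upper bound v, so that i precedes -i
in v. *)

(** * Letters and signed permutations *)

Section SignedLetters.
Variable n : nat.
Implicit Types (a b c x y : pm n) (i j k : 'I_n) (u v : {perm pm n}).

(** The order of the letters as integers. *)
Definition pm_lt a b : bool := (pm_val a < pm_val b)%R.

Lemma pm_ltE a b : pm_lt a b =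
  if a.1 then (if b.1 then b.2 < a.2 else true)
  else (if b.1 then false else a.2 < b.2).
Proof.
by case: a b => [[] k] [[] l]; rewrite /pm_lt /pm_val /= ?expr1z ?expr0z; lia.
Qed.

Lemma pm_val_gt0 a : (0 < pm_val a)%R = ~~ a.1.
Proof. by case: a => [[] k]; rewrite /pm_val /=; lia. Qed.

Lemma pm_val_abs a : `|pm_val a|%N = a.2.+1.
Proof. by case: a => [[] k]; rewrite /pm_val /=; lia. Qed.

Lemma pm_val_pos k : pm_val (pos k) = (k.+1%:Z)%R.
Proof. by rewrite /pm_val /= mul1r. Qed.

Lemma pm_val_neg k : pm_val (neg k) = (- k.+1%:Z)%R.
Proof. by rewrite /pm_val /= mulN1r. Qed.

Lemma pm_val_inj : injective (@pm_val n).
Proof.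
move=> [s k] [t l] E; have /= := pm_val_abs (s, k); rewrite E pm_val_abs /=.
move=> [kl]; have := pm_val_gt0 (s, k); rewrite E pm_val_gt0 /=.
by rewrite (val_inj kl) => /negb_inj ->.
Qed.

Lemma pm_oppK : involutive (@opp n).
Proof. by case=> [s k]; rewrite /opp /= negbK. Qed.

Lemma pm_opp_inj : injective (@opp n).
Proof. exact: inv_inj pm_oppK. Qed.

Lemma opp_pos k : opp (pos k) = neg k. Proof. by []. Qed.
Lemma opp_neg k : opp (neg k) = pos k. Proof. by []. Qed.

Lemma pm_lt_opp a b : pm_lt (opp a) (opp b) = pm_lt b a.
Proof. by rewrite !pm_ltE /=; case: a b => [[] k] [[] l]. Qed.

Lemma pm_lt_trans : transitive pm_lt.
Proof. by move=> a b c; apply: lt_trans. Qed.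

Lemma pm_ltxx a : pm_lt a a = false.
Proof. exact: ltxx. Qed.

Lemma pm_lt_asym a b : pm_lt a b -> pm_lt b a = false.
Proof. by move=> ab; apply/negP => /(pm_lt_trans ab); rewrite pm_ltxx. Qed.

Lemma pm_lt_total a b : a != b -> pm_lt a b || pm_lt b a.
Proof. by rewrite /pm_lt -neq_lt (inj_eq pm_val_inj). Qed.

Lemma SB_opp u a : u \in SB n -> u (opp a) = opp (u a).
Proof. by move/SBP. Qed.

Lemma SBV_opp u a : u \in SB n -> u^-1 (opp a) = opp (u^-1 a).
Proof. by move=> uB; rewrite SB_opp ?groupV. Qed.

(** The pair of letters (a, b), with a < b, is an inversion of u: an inversion is
recorded by values, not by positions. *)
Definition inverted u a b : bool := pm_lt a b && pm_lt (u^-1 b) (u^-1 a).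

Lemma inverted_opp u a b : u \in SB n -> inverted u (opp b) (opp a) = inverted u a b.
Proof. by move=> uB; rewrite /inverted !SBV_opp // !pm_lt_opp. Qed.

Lemma inverted1 a b : inverted 1 a b = false.
Proof.
by rewrite /inverted invg1 !perm1; case ab: (pm_lt a b) => //=; rewrite pm_lt_asym.
Qed.

(** Among the pairs (a, b) with a < b, the condition selects exactly one member of
each orbit {(a, b), (-b, -a)}: it says that b is positive and |a| <= b. *)
Definition canon_pair (e : pm n * pm n) : bool :=
  ~~ e.2.1 && (e.1.2 <= e.2.2).

(** The number of mirror orbits of inversions. *)
Definition num_inv u : nat :=
  #|[set e : pm n * pm n | inverted u e.1 e.2 && canon_pair e]|.

(** The adjacent positions exchanged by s_i are lo i < hi i, together with their
opposites.  For i = 0 these are -1 < 1, and the two pairs coincide. *)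
Definition lo i : pm n := if i == 0 :> nat then neg i else pos (ord_prev i).
Definition hi i : pm n := pos i.

Lemma lo_lt_hi i : pm_lt (lo i) (hi i).
Proof. by rewrite pm_ltE /lo; case: eqP => //=; lia. Qed.

Lemma tperm_if (T : finType) (a b x : T) :
  tperm a b x = if x == a then b else if x == b then a else x.
Proof.
by case: tpermP => [->|->|/eqP/negPf-> /eqP/negPf->] //;
  by rewrite eqxx; case: (b =P a) => [->|].
Qed.

Lemma cox_genE i x : cox_gen i x =
  if i == 0 :> nat then (x.1 (+) (x.2 == i), x.2)
  else (x.1, tperm (ord_prev i) i x.2).
Proof.
case: x => [s k]; rewrite /cox_gen; case: ifPn => i0 /=.
  by rewrite tperm_if !xpair_eqE; case: s => /=; case: eqP => //= ->.
have E: (i == ord_prev i) = false by apply/negP => /eqP/(congr1 val) /=; lia.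
rewrite permM !tperm_if !xpair_eqE; case: s => /=.
  by rewrite !xpair_eqE /=; case: ifP => // _; case: ifP.
by case: (k == ord_prev i) => //; case: (k == i).
Qed.

Lemma cox_gen_SB i : cox_gen i \in SB n.
Proof. by apply/SBP => x; rewrite !cox_genE; case: ifP; rewrite // addNb. Qed.

Lemma cox_genK i : involutive (cox_gen i).
Proof.
case=> s k; rewrite !cox_genE; case: (val i == 0) => /=; first by rewrite addbK.
by rewrite tpermK.
Qed.

Lemma cox_genV i : (cox_gen i)^-1 = cox_gen i.
Proof. by apply/permP => x; rewrite -[in LHS](cox_genK i x) permK. Qed.

Lemma cox_gen_lo i : cox_gen i (lo i) = hi i.
Proof. by rewrite cox_genE /lo; case: (val i == 0); rewrite /= ?eqxx ?tpermL. Qed.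

Lemma cox_gen_hi i : cox_gen i (hi i) = lo i.
Proof. by rewrite -cox_gen_lo cox_genK. Qed.

(** A generator reverses only the adjacent pairs that it exchanges. *)
Lemma cox_gen_lt i x y : (x, y) != (lo i, hi i) ->
  (x, y) != (opp (hi i), opp (lo i)) ->
  pm_lt x y -> pm_lt (cox_gen i x) (cox_gen i y).
Proof.
case: x y => [s k] [t l]; rewrite !cox_genE /lo /hi !pm_ltE.
rewrite /neg /pos /opp; case: ifPn => i0 /=; rewrite !xpair_eqE /=.
  rewrite -!val_eqE /=; case: (nat_of_ord k =P i) => Ek;
    by case: (nat_of_ord l =P i) => El; case: s; case: t => /=; lia.
have E: nat_of_ord (ord_prev i) = i.-1 by [].
rewrite !tperm_if -!val_eqE /=.
case: (nat_of_ord k =P i.-1) => E1; case: (nat_of_ord k =P i) => E2;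
  case: (nat_of_ord l =P i.-1) => E3; case: (nat_of_ord l =P i) => E4;
  by case: s; case: t => /=; lia.
Qed.

(** * Weak order by inclusion of inversions *)

Lemma cox_gen_ltE i x y : (x, y) != (lo i, hi i) ->
  (x, y) != (opp (hi i), opp (lo i)) ->
  (x, y) != (hi i, lo i) -> (x, y) != (opp (lo i), opp (hi i)) ->
  pm_lt (cox_gen i x) (cox_gen i y) = pm_lt x y.
Proof.
move=> n1 n2 n3 n4; apply/idP/idP; last exact: cox_gen_lt.
have gN z : cox_gen i (opp z) = opp (cox_gen i z) by rewrite SB_opp ?cox_gen_SB.
have gE z t : cox_gen i z = t -> z = cox_gen i t by move<-; rewrite cox_genK.
have := @cox_gen_lt i (cox_gen i x) (cox_gen i y); rewrite !cox_genK => h.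
move=> gxy; apply: h => //; apply/eqP => -[/gE Ex /gE Ey].
- by case/eqP: n3; rewrite Ex Ey cox_gen_lo cox_gen_hi.
- by case/eqP: n4; rewrite Ex Ey !gN cox_gen_lo cox_gen_hi.
Qed.

(** The product cox_gen i * u stands for the composite of maps u \o s_i. *)
Lemma inverted_ascent u i a b : u \in SB n -> pm_lt (u (lo i)) (u (hi i)) ->
  inverted (cox_gen i * u) a b =
  [|| inverted u a b, (a, b) == (u (lo i), u (hi i)) |
      (a, b) == (opp (u (hi i)), opp (u (lo i)))].
Proof.
move=> uB up; rewrite /inverted invMg cox_genV !permM.
have uN z : u (opp z) = opp (u z) by rewrite SB_opp.
have gN z : cox_gen i (opp z) = opp (cox_gen i z) by rewrite SB_opp ?cox_gen_SB.
have up' : pm_lt (u (opp (hi i))) (u (opp (lo i))) by rewrite !uN pm_lt_opp.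
have [x ->] : exists x, a = u x by exists (u^-1 a); rewrite permKV.
have [y ->] : exists y, b = u y by exists (u^-1 b); rewrite permKV.
rewrite !permK.
rewrite -!uN !xpair_eqE !(inj_eq perm_inj) -!xpair_eqE.
have [[-> ->]|n1] := eqVneq (x, y) (lo i, hi i).
  by rewrite cox_gen_lo cox_gen_hi lo_lt_hi up ?orbT.
have [[-> ->]|n2] := eqVneq (x, y) (opp (hi i), opp (lo i)).
  by rewrite !gN cox_gen_lo cox_gen_hi pm_lt_opp lo_lt_hi up' ?orbT.
rewrite !orbF; case xy: (pm_lt (u x) (u y)) => //=.
apply: cox_gen_ltE; apply/eqP => -[Ex Ey].
- by rewrite Ex Ey pm_lt_asym in xy.
- by rewrite Ex Ey pm_lt_asym in xy.
- by rewrite Ex Ey eqxx in n1.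
- by rewrite Ex Ey eqxx in n2.
Qed.

Lemma canon_pair_mirror (a b : pm n) : pm_lt a b ->
  canon_pair (a, b) || canon_pair (opp b, opp a).
Proof.
by rewrite pm_ltE /canon_pair /=; case: a b => [[] k] [[] l] /=; lia.
Qed.

Lemma canon_pair_mirror_eq (a b : pm n) : pm_lt a b ->
  canon_pair (a, b) -> canon_pair (opp b, opp a) -> (a, b) = (opp b, opp a).
Proof.
rewrite pm_ltE /canon_pair /opp /=; case: a b => [[] k] [[] l] //= _ lk kl.
by rewrite (_ : k = l) //; apply/val_inj/eqP; rewrite eqn_leq lk kl.
Qed.

Lemma num_inv_ascent u i : u \in SB n -> pm_lt (u (lo i)) (u (hi i)) ->
  num_inv (cox_gen i * u) = (num_inv u).+1.
Proof.
move=> uB up; rewrite /num_inv.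
set e := (u (lo i), u (hi i)); set e' := (opp (u (hi i)), opp (u (lo i))).
have eN : inverted u e.1 e.2 = false.
  by rewrite /inverted /= !permK (pm_lt_asym (lo_lt_hi i)) andbF.
have e'N : inverted u e'.1 e'.2 = false by rewrite inverted_opp.
set S := (X in _ = #|pred_of_set X|.+1).
(* e0 is the selected member of the orbit that is added. *)
have [e0 [e0c e0N e0P]]: exists e0 : pm n * pm n, [/\ canon_pair e0,
    inverted u e0.1 e0.2 = false &
    forall f, canon_pair f -> (f == e) || (f == e') = (f == e0)].
  have [ec|ec] := boolP (canon_pair e).
    exists e; split=> // f fc; case: (f =P e') => [E|]; rewrite ?orbF //.
    rewrite E in fc *; rewrite orbT; apply/esym/eqP/esym.
    exact: (canon_pair_mirror_eq up ec fc).
  have e'c : canon_pair e' by move: (canon_pair_mirror up); rewrite (negPf ec).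
  exists e'; split=> // f fc; case: (f =P e) => [E|] //.
  by rewrite E (negPf ec) in fc.
rewrite (_ : [set _ | _] = e0 |: S) ?cardsU1 ?inE ?e0N //.
apply/setP => f; rewrite !inE inverted_ascent // -surjective_pairing.
have [fc|fc] := boolP (canon_pair f); last first.
  by rewrite !andbF; apply/esym/negP => /orP[/eqP E|//]; rewrite E e0c in fc.
by rewrite !andbT e0P // orbC.
Qed.

Lemma SB_cox u i : u \in SB n -> cox_gen i * u \in SB n.
Proof. by move=> uB; rewrite groupM ?cox_gen_SB. Qed.

Lemma descent_ascent u i : ~~ pm_lt (u (lo i)) (u (hi i)) ->
  pm_lt ((cox_gen i * u) (lo i)) ((cox_gen i * u) (hi i)).
Proof.
move=> nup; rewrite !permM cox_gen_lo cox_gen_hi.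
have := pm_lt_total (_ : u (lo i) != u (hi i)); rewrite (negPf nup); apply.
by rewrite (inj_eq perm_inj); apply/eqP=> E; have:= lo_lt_hi i; rewrite E pm_ltxx.
Qed.

Lemma cox_genKg u i : cox_gen i * (cox_gen i * u) = u.
Proof. by apply/permP => x; rewrite !permM cox_genK. Qed.

Lemma num_inv_descent u i : u \in SB n -> ~~ pm_lt (u (lo i)) (u (hi i)) ->
  num_inv u = (num_inv (cox_gen i * u)).+1.
Proof.
move=> uB /descent_ascent /(num_inv_ascent (SB_cox i uB)).
by rewrite cox_genKg.
Qed.

Lemma word_prod_rcons (w : seq 'I_n) i :
  word_prod (rcons w i) = cox_gen i * word_prod w :> {perm pm n}.
Proof. by rewrite /word_prod rev_rcons big_cons. Qed.

Lemma word_prod_SB (w : seq 'I_n) : word_prod w \in SB n.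
Proof.
elim/last_ind: w => [|w i IH]; last by rewrite word_prod_rcons SB_cox.
by rewrite /word_prod big_nil group1.
Qed.

Lemma num_inv1 : num_inv 1 = 0.
Proof.
by apply/eqP; rewrite cards_eq0; apply/eqP/setP => e; rewrite !inE inverted1.
Qed.

(** In the case of equality every letter of x is an ascent, so that inversions only
accumulate along x. *)
Lemma num_inv_cat (w x : seq 'I_n) :
  num_inv (word_prod (w ++ x)) <= num_inv (word_prod w) + size x
  /\ (num_inv (word_prod (w ++ x)) = num_inv (word_prod w) + size x ->
      forall a b, inverted (word_prod w) a b -> inverted (word_prod (w ++ x)) a b).
Proof.
elim/last_ind: x => [|x i [le_x eq_x]]; first by rewrite cats0 addn0.
rewrite -rcons_cat word_prod_rcons size_rcons.
have uB := word_prod_SB (w ++ x); move: le_x eq_x uB.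
set u := word_prod (w ++ x) => le_x eq_x uB.
have [up|dn] := boolP (pm_lt (u (lo i)) (u (hi i))); last first.
  by have := num_inv_descent uB dn; split=> [|E]; lia.
rewrite num_inv_ascent //; split=> [|E a b ab]; first by lia.
by rewrite inverted_ascent // eq_x //; lia.
Qed.

Lemma num_inv_size (w : seq 'I_n) : num_inv (word_prod w) <= size w.
Proof.
by have [] := num_inv_cat [::] w; rewrite /word_prod /= big_nil num_inv1.
Qed.

(** If u and v differ, the letters of u at some adjacent positions occur in v in the
opposite order: otherwise u followed by the inverse of v would increase along all
adjacent positions, and so be the identity. *)
Lemma exists_ascent u v : u \in SB n -> v \in SB n -> u != v ->
  exists i, pm_lt (v^-1 (u (hi i))) (v^-1 (u (lo i))).
Proof.
move=> uB vB uv; set w := u * v^-1; have wB : w \in SB n by rewrite groupM ?groupV.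
suff: exists i, ~~ pm_lt (w (lo i)) (w (hi i)).
  case=> i /descent_ascent; rewrite !permM cox_gen_lo cox_gen_hi => h.
  by exists i.
apply/existsP; rewrite -negb_forall; apply: contra uv => /forallP mono.
pose f k := (w (pos k)).2.
have wpos k : w (pos k) = pos (f k) /\ k <= f k.
  case: k; elim=> [|k IH] lt_k.
    have := mono (Ordinal lt_k); rewrite /lo /hi /= -opp_pos SB_opp // /f.
    by case: (w _) => [[] l]; rewrite pm_ltE.
  have [E le] := IH (ltnW lt_k).
  have := mono (Ordinal lt_k); rewrite /lo /hi /=.
  rewrite (_ : ord_prev _ = Ordinal (ltnW lt_k)); last exact: val_inj.
  rewrite E; move: (f (Ordinal (ltnW lt_k))) le => m le; rewrite /f.
  case: (w _) => [[] l]; rewrite pm_ltE //= => lt_l.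
  by split=> //; apply: leq_ltn_trans le lt_l.
have f_inj : injective f.
  by move=> k l E; have := proj1 (wpos k); rewrite E -(proj1 (wpos l)) => /perm_inj [].
have fE k : f k = k.
  (* k <= f k for all k, while f permutes the index set. *)
  have Es : \sum_k f k = \sum_(k < n) k by rewrite [RHS](reindex_inj f_inj).
  have : \sum_k (f k - k) == 0.
    by rewrite sumnB ?Es ?subnn // => l _; case: (wpos l).
  rewrite sum_nat_eq0 => /forallP/(_ k)/implyP/(_ isT).
  by have [_ le] := wpos k => le'; apply/val_inj/eqP; rewrite eqn_leq le -subn_eq0 le'.
have w1 : w = 1.
  have wp k : w (pos k) = pos k by case: (wpos k) => ->; rewrite fE.
  apply/permP => -[[] k]; rewrite perm1 ?wp //.
  by rewrite -[(true, k)]/(neg k) -opp_pos SB_opp // wp.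
by rewrite eq_sym eq_mulgV1 -invg1 -w1 /w invMg invgK.
Qed.

(** Any word for u extends to a word for v by num_inv v - num_inv u letters: as long
as u differs from v, some ascent of u is an inversion of v. *)
Lemma inverted_sub_word u v : u \in SB n -> v \in SB n ->
  (forall a b, inverted u a b -> inverted v a b) ->
  exists x : seq 'I_n, (forall w, word_prod w = u -> word_prod (w ++ x) = v) /\
     num_inv v = num_inv u + size x.
Proof.
move=> uB vB; have [m] := ubnP (num_inv v - num_inv u).
elim: m u uB => // m IH u uB lt_m sub.
have [->|/(exists_ascent uB vB) [i vi]] := eqVneq u v.
  by exists [::]; rewrite addn0; split=> // w; rewrite cats0.
have up : pm_lt (u (lo i)) (u (hi i)).
  apply/negPn/negP => /descent_ascent; rewrite !permM cox_gen_lo cox_gen_hi => dn.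
  have /sub : inverted u (u (hi i)) (u (lo i)) by rewrite /inverted dn !permK lo_lt_hi.
  by rewrite /inverted (pm_lt_asym vi) andbF.
have sub' a b : inverted (cox_gen i * u) a b -> inverted v a b.
  have vup : inverted v (u (lo i)) (u (hi i)) by rewrite /inverted up vi.
  rewrite inverted_ascent // => /or3P[/sub|/eqP[-> ->]|/eqP[-> ->]] //.
  by rewrite inverted_opp.
have le_uv : num_inv (cox_gen i * u) <= num_inv v.
  apply/subset_leq_card/subsetP => e; rewrite !inE => /andP[/sub' -> ->].
  by [].
have N_u := num_inv_ascent uB up.
have [|x [xP xN]] := IH _ (SB_cox i uB) _ sub'; first by lia.
exists (i :: x); split=> [w wu|/=]; last by lia.
by rewrite -cat_rcons xP // word_prod_rcons wu.
Qed.

(** The length is the number of mirror orbits of inversions. *)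
Lemma reduced_exprP u w :
  reduced_expr u w <-> word_prod w = u /\ size w = num_inv u.
Proof.
split=> [[wu wm]|[wu ws]]; split=> //; last first.
  by move=> w' w'u; rewrite ws -w'u num_inv_size.
have uB : u \in SB n by rewrite -wu word_prod_SB.
have [] := inverted_sub_word (group1 _) uB; first by move=> a b; rewrite inverted1.
move=> x [xP xN]; apply/eqP; rewrite eqn_leq -{2}wu num_inv_size andbT.
by rewrite xN num_inv1 wm // -(xP [::]) // /word_prod big_nil.
Qed.

(** The weak order is inclusion of inversion sets. *)
Lemma leRP u v : u \in SB n -> v \in SB n ->
  leR u v <-> (forall a b, inverted u a b -> inverted v a b).
Proof.
move=> uB vB; split=> [[w [w' []]]|sub].
  move=> /reduced_exprP[wu ws] /reduced_exprP[w'v w's] /prefixP[x E].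
  rewrite -wu -w'v E; apply: (proj2 (num_inv_cat w x)).
  by rewrite -E w'v wu -w's -ws E size_cat.
have [|x [xP xN]] := inverted_sub_word (group1 _) uB.
  by move=> a b; rewrite inverted1.
have [y [yP yN]] := inverted_sub_word uB vB sub.
have xu : word_prod x = u by rewrite -(xP [::]) // /word_prod big_nil.
exists x, (x ++ y); split; last exact: prefix_prefix.
  by apply/reduced_exprP; rewrite xu xN num_inv1.
by apply/reduced_exprP; rewrite yP // size_cat yN xN num_inv1.
Qed.

End SignedLetters.

(** * Order of the letters of a string *)
Section Before.
Variable T : eqType.
Implicit Types (a b x : T) (s : seq T).

(** The letter a occurs in s before b; this also holds when b does not occur. *)
Definition before s a b : bool := index a s < index b s.

(** Erasing other letters does not change the order of two letters. *)
Lemma before_filter (P : pred T) s a b : P a -> P b ->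
  before (filter P s) a b = before s a b.
Proof.
rewrite /before => Pa Pb; elim: s => //= x s IH; case: ifP => Px /=.
  by case: (x =P a); case: (x =P b); rewrite ?ltnS.
have [E|_] := eqVneq x a; first by rewrite E Pa in Px.
by have [E|_] := eqVneq x b; rewrite ?ltnS ?IH //; rewrite E Pb in Px.
Qed.

Lemma before_total s a b : a \in s -> a != b -> before s a b || before s b a.
Proof.
move=> sa ab; rewrite /before -neq_ltn; apply: contra ab => /eqP E.
have sb : b \in s by rewrite -index_mem -E index_mem.
by rewrite -(nth_index a sa) E nth_index.
Qed.

Lemma before_asym s a b : before s a b -> before s b a = false.
Proof. by rewrite /before; lia. Qed.

Lemma index_rev s a : uniq s -> a \in s ->
  index a (rev s) = size s - (index a s).+1.
Proof.
move=> us sa; have lt := sa; rewrite -index_mem in lt.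
rewrite -{1}(nth_index a sa) (_ : nth a s _ = nth a (rev s) (size s - (index a s).+1)).
  by rewrite index_uniq ?rev_uniq // size_rev; lia.
by rewrite nth_rev; [congr nth; lia | lia].
Qed.

Lemma before_rev s a b : uniq s -> a \in s -> b \in s ->
  before (rev s) a b = before s b a.
Proof.
move=> us sa sb; rewrite /before !index_rev //.
by move: sa sb; rewrite -!index_mem; lia.
Qed.

Lemma before_map (f : T -> T) s a b : injective f ->
  before (map f s) (f a) (f b) = before s a b.
Proof. by move=> f_inj; rewrite /before !index_map. Qed.

Lemma before_insert s1 s2 x a : uniq (s1 ++ s2) -> x \notin s1 ++ s2 ->
  a \in s1 ++ s2 -> before (s1 ++ x :: s2) x a = (a \in s2).
Proof.
rewrite mem_cat cat_uniq negb_or => /and3P[_ /hasPn dis _] /andP[x1 x2] a12.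
rewrite /before !index_cat (negPf x1) /= eqxx addn0.
have [a2|a2] := boolP (a \in s2).
  rewrite (negPf (dis _ a2)); case: eqP => [E|]; last by lia.
  by rewrite E a2 in x2.
have a1 : a \in s1 by move: a12; rewrite mem_cat (negPf a2) orbF.
by rewrite a1; apply/negbTE; rewrite -leqNgt ltnW // index_mem.
Qed.

End Before.

Section Insertion.
Variable n : nat.
Implicit Types (a b c x y : pm n) (i j k : 'I_n) (u v : {perm pm n})
  (q A B C : seq (pm n)).

(** * Centrally symmetric strings *)

(** Reverse the string and negate its letters; the complete notation of a signed
permutation is fixed by this operation. *)
Definition mirror q : seq (pm n) := rev (map (@opp n) q).

Lemma mirrorK : involutive mirror.
Proof. by move=> q; rewrite /mirror map_rev revK mapK //; apply: pm_oppK. Qed.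

Lemma size_mirror q : size (mirror q) = size q.
Proof. by rewrite size_rev size_map. Qed.

Lemma mirror_cat q1 q2 : mirror (q1 ++ q2) = mirror q2 ++ mirror q1.
Proof. by rewrite /mirror map_cat rev_cat. Qed.

Lemma mirror_cons x q : mirror (x :: q) = rcons (mirror q) (opp x).
Proof. by rewrite /mirror /= rev_cons. Qed.

Lemma before_mirror q a b : uniq q -> mirror q = q -> a \in q -> b \in q ->
  before q (opp b) (opp a) = before q a b.
Proof.
move=> uq sq qa qb; rewrite -{1}sq /mirror -map_rev before_map ?before_rev //.
exact: pm_opp_inj.
Qed.

Lemma mirror_split A B C : size A = size C -> mirror (A ++ B ++ C) = A ++ B ++ C ->
  mirror C = A /\ mirror B = B.
Proof.
move=> sAC; rewrite !mirror_cat -catA => /eqP.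
rewrite eqseq_cat ?size_mirror // => /andP[/eqP -> /eqP E]; split=> //.
by move/eqP: E; rewrite eqseq_cat ?size_mirror // => /andP[/eqP].
Qed.

(** The string q' arises from q = C ++ Cs by inserting the letters pos k and neg k in
opposite places, with pos k in front of Cs; m tells whether pos k comes first. *)
Definition inserted k q C Cs (m : bool) q' : Prop :=
  [/\ perm_eq q' (pos k :: neg k :: q),
      filter (predC1 (neg k)) q' = C ++ pos k :: Cs,
      mirror q' = q' & before q' (pos k) (neg k) = m].

(** If A and D have the same length, inserting x after A and opp x before D gives a
symmetric string.  The suffix that pos k precedes is B ++ D for x = pos k, and D
for x = neg k. *)
Lemma inserted_split k q A B D x : q = A ++ B ++ D -> size A = size D ->
  mirror q = q -> pos k \notin q -> neg k \notin q -> x \in [:: pos k; neg k] ->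
  inserted k q (if x == pos k then A else A ++ B) (if x == pos k then B ++ D else D)
    (x == pos k) (A ++ x :: B ++ opp x :: D).
Proof.
move=> -> sAD sq; rewrite !mem_cat !negb_or => /and3P[pA pB pD] /and3P[nA nB nD] xpn.
have [mD mB] := mirror_split sAD sq.
have mA : mirror A = D by rewrite -mD mirrorK.
have fid (s : seq (pm n)) : neg k \notin s -> filter (predC1 (neg k)) s = s.
  by move=> ns; apply/all_filterP/allP => y ys /=; apply: contraNneq ns => <-.
have pn : (neg k == pos k) = false by [].
split.
- rewrite perm_sym; apply/seq.permP => P; move: xpn; rewrite !inE => /orP[]/eqP ->;
    rewrite -?opp_pos /= !count_cat /= !count_cat /= ?opp_pos ?opp_neg; lia.
- by move: xpn; rewrite !inE => /orP[]/eqP ->;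
   rewrite ?eqxx ?pn !filter_cat /= !filter_cat /= ?eqxx ?pn /= !fid -?catA.
- by rewrite !(mirror_cat, mirror_cons) mA mB mD pm_oppK -!cats1 -!catA.
move: xpn; rewrite !inE => /orP[]/eqP ->;
  rewrite ?eqxx ?pn /before !index_cat ?(negPf nA) ?(negPf pA) /= ?eqxx ?pn /=.
  by lia.
by rewrite !index_cat (negPf pB) /=; lia.
Qed.

(** * One step of the algorithm *)

(** The shortest suffix of q that contains H starts with a letter of H, unless it is
empty: otherwise its tail would still contain H. *)
Lemma suffix_lenP (H : {set pm n}) q : {subset H <= q} ->
  let m := suffix_len H (map (@pm_val n) q) in
  [/\ m <= size q, {subset H <= drop (size q - m) q} &
      forall c s, drop (size q - m) q = c :: s -> uniq q -> c \in H].
Proof.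
move=> Hq; cbv zeta; rewrite /suffix_len size_map.
set P := (fun m : nat => _); set m := find P _.
have PE l : P l = [forall a in H, a \in drop (size q - l) q].
  by apply: eq_forallb => a; rewrite -map_drop mem_map //; apply: pm_val_inj.
have hasP : has P (iota 0 (size q).+1).
  apply/hasP; exists (size q); first by rewrite mem_iota /=; lia.
  by rewrite PE subnn drop0; apply/forall_inP.
have m_le : m <= size q by move: hasP; rewrite has_find size_iota ltnS.
have Pm : P m.
  by have := nth_find 0 hasP; rewrite -/m nth_iota // ltnS.
split=> //; first by move=> a Ha; move: Pm; rewrite PE => /forall_inP; apply.
move=> c s E uq; have m_gt0 : 0 < m.
  by case: (posnP m) E => // ->; rewrite subn0 drop_size.
have [] : P m.-1 = false /\ drop (size q - m.-1) q = s.
  split; last first.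
    rewrite (_ : size q - m.-1 = 1 + (size q - m)); last by lia.
    by rewrite -drop_drop E /= drop0.
  have := @before_find _ 0 P (iota 0 (size q).+1) m.-1.
  rewrite -/m nth_iota ?add0n; first by apply; rewrite prednK.
  by rewrite ltnS (leq_trans (leq_pred m)).
rewrite PE => /negbT/forall_inPn[a Ha] ns Es; rewrite Es in ns.
move: (Pm); rewrite PE => /forall_inP/(_ a Ha); rewrite E inE (negPf ns) orbF.
by move/eqP <-.
Qed.

Lemma Hset_le u k a : (a \in Hset u k) = (a.2 < k) && inverted u a (pos k).
Proof.
rewrite inE pm_val_abs /inverted; case ak: (a.2 < k) => //=; rewrite pm_ltE.
by case: a ak => [[] l] /= ak; rewrite ?ak.
Qed.

(** All cases of the algorithm are insertions in opposite places.  With the letter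
i = k + 1, the last argument of inserted says that i precedes -i when Cs has length
at least i, or when it has length i - 1 and i is in the negative half of s or t. *)
Lemma join_stepP (s t : {perm pm n}) k q : uniq q -> mirror q = q ->
  (forall a, (a \in q) = (a.2 < k)) ->
  size q = k.*2 ->
  let pos_st := ~~ (s^-1 (pos k)).1 && ~~ (t^-1 (pos k)).1 in
  exists C Cs q', [/\ q = C ++ Cs,
    forall a, a.2 < k -> inverted s a (pos k) || inverted t a (pos k) -> a \in Cs,
    forall c r, Cs = c :: r -> inverted s c (pos k) || inverted t c (pos k),
    join_step s t (map (@pm_val n) q) k = map (@pm_val n) q' &
    inserted k q C Cs ((k < size Cs) || (size Cs == k) && ~~ pos_st) q'].
Proof.
move=> uq sq memq szq pos_st.
have pq : pos k \notin q by rewrite memq ltnn.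
have nq : neg k \notin q by rewrite memq ltnn.
set H := Hset s k :|: Hset t k.
have memH a : (a \in H) = (a.2 < k) && (inverted s a (pos k) || inverted t a (pos k)).
  by rewrite inE !Hset_le -andb_orr.
have [] := @suffix_lenP H q; first by move=> a; rewrite memH memq => /andP[].
set m := suffix_len _ _ => m_le Hsub Hhd.
set C := take (size q - m) q; set Cs := drop (size q - m) q.
have qE : q = C ++ Cs by rewrite cat_take_drop.
have szCs : size Cs = m by rewrite size_drop; lia.
have szC : size C = size q - m by rewrite size_take; case: ifP; lia.
suff [q' [E I]] : exists q', join_step s t (map (@pm_val n) q) k = map (@pm_val n) q' /\
    inserted k q C Cs ((k < size Cs) || (size Cs == k) && ~~ pos_st) q'.
  exists C, Cs, q'; split=> // [a ak sta|c r Ec].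
    by apply: Hsub; rewrite memH ak.
  by have := Hhd _ _ Ec uq; rewrite memH => /andP[].
rewrite /join_step !pm_val_gt0 -/pos_st.
have px : pos k \in [:: pos k; neg k] by rewrite inE eqxx.
have nx : neg k \in [:: pos k; neg k] by rewrite !inE eqxx orbT.
have pn : (neg k == pos k) = false by [].
have middle : size Cs = k -> exists q', (map (@pm_val n) C) ++
    (if pos_st then [:: (- k.+1%:Z)%R; k.+1%:Z%R] else [:: k.+1%:Z%R; (- k.+1%:Z)%R]) ++
    map (@pm_val n) Cs = map (@pm_val n) q' /\
    inserted k q C Cs ((k < size Cs) || (size Cs == k) && ~~ pos_st) q'.
  move=> sz; have sz' : size C = size Cs by lia.
  exists (C ++ (if pos_st then [:: neg k; pos k] else [:: pos k; neg k]) ++ Cs).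
  split; first by rewrite !map_cat; case: ifP; rewrite /= pm_val_pos pm_val_neg.
  rewrite sz ltnn eqxx /=; case: (pos_st).
    have := @inserted_split k q C [::] Cs (neg k) qE sz' sq pq nq nx.
    by rewrite cats0 pn.
  have := @inserted_split k q C [::] Cs (pos k) qE sz' sq pq nq px.
  by rewrite eqxx.
case: ifP => k0.
  (* For k = 0 all strings are empty and the rule is that of the middle case. *)
  have q0 : q = [::] by apply/nilP; rewrite /nilp szq; lia.
  have [|q' [Eq Iq]] := middle; first by lia.
  exists q'; split=> //; rewrite -Eq /C /Cs q0 /= cats0.
  by move/eqP: k0 => ->.
rewrite /insert_letter -/H -/m size_map -map_take -map_drop -/C -/Cs !size_map.
case: ifP => [le|nle].
  set d := size Cs - size C.
  exists (C ++ [:: pos k] ++ take d Cs ++ [:: neg k] ++ drop d Cs); split.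
    by rewrite !map_cat map_take map_drop /= pm_val_pos pm_val_neg.
  rewrite orTb.
  have := @inserted_split k q C (take d Cs) (drop d Cs) (pos k) _ _ sq pq nq px.
  rewrite cat_take_drop eqxx; apply=> //.
  by rewrite size_drop /d; lia.
case: ifP => [le|nle2].
  exists (take (size Cs) C ++ [:: neg k] ++ drop (size Cs) C ++ [:: pos k] ++ Cs); split.
    by rewrite !map_cat map_take map_drop /= pm_val_pos pm_val_neg.
  rewrite (_ : (size Cs == k) = false); last by apply/negP => /eqP; lia.
  have := @inserted_split k q (take (size Cs) C) (drop (size Cs) C) Cs (neg k)
    _ _ sq pq nq nx.
  rewrite cat_take_drop pn; apply=> //; first by rewrite catA cat_take_drop.
  by rewrite size_take; case: ifP; lia.
have [|q' [Eq Iq]] := middle; first by lia.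
exists q'; split; last by move: Iq; rewrite nle.
rewrite -Eq; case: (pos_st); by rewrite /= ?catA.
Qed.

End Insertion.

(** * The invariant of the algorithm *)
Section Invariant.
Variable n : nat.
Implicit Types (u v : {perm pm n}) (a b c x y : pm n) (i j k : 'I_n)
  (q A B C : seq (pm n)).
Variables s t : {perm pm n}.
Hypotheses (sB : s \in SB n) (tB : t \in SB n).

(** Inversions of s or of t, and the signed permutations having all of them. *)
Definition inv_st a b : bool := inverted s a b || inverted t a b.

Definition upper_bound v : Prop :=
  v \in SB n /\ forall a b, inv_st a b -> inverted v a b.

(** The string q is a symmetric arrangement of the letters of absolute value at most
k; it inverts every inversion of s or t between these letters, and only pairs that
are inverted in every upper bound. *)
Record join_inv (k : nat) q : Prop := JoinInv {
  ji_uniq : uniq q;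
  ji_mirror : mirror q = q;
  ji_mem : forall a, (a \in q) = (a.2 < k);
  ji_size : size q = k.*2;
  ji_upper : forall a b, a \in q -> b \in q -> inv_st a b -> before q b a;
  ji_least : forall v, upper_bound v -> forall a b, a \in q -> b \in q ->
    pm_lt a b -> before q b a -> inverted v a b }.

Lemma inv_st_opp a b : inv_st (opp b) (opp a) = inv_st a b.
Proof. by rewrite /inv_st !inverted_opp. Qed.

Lemma inv_st_lt a b : inv_st a b -> pm_lt a b.
Proof. by case/orP => /andP[]. Qed.

Lemma inverted_trans (u : {perm pm n}) : transitive (inverted u).
Proof.
move=> b a c /andP[ab ba] /andP[bc cb].
by rewrite /inverted (pm_lt_trans ab bc) (pm_lt_trans cb ba).
Qed.

Lemma pm_lt_pos a k : a.2 < k -> pm_lt a (pos k).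
Proof. by rewrite pm_ltE; case: a => [[] l]. Qed.

Lemma upper_of v : upper_bound v -> forall a b, inv_st a b -> inverted v a b.
Proof. by case. Qed.

(** Although only its first letter c is known to follow pos k in s or in t, the whole
suffix Cs follows pos k in every upper bound. *)
Lemma suffix_upper k q C Cs v : join_inv k q -> q = C ++ Cs ->
  (forall c r, Cs = c :: r -> inv_st c (pos k)) -> upper_bound v ->
  forall a, a \in Cs -> inverted v a (pos k).
Proof.
move=> [uq _ memq _ up least] qE hd vub a aCs.
case E: Cs aCs => [//|c r] aCs.
have cH := hd _ _ E; have cv := upper_of vub cH.
have [->//|ac] := eqVneq a c.
have qa : a \in q by rewrite qE E mem_cat aCs orbT.
have qc : c \in q by rewrite qE E mem_cat inE eqxx !orbT.
have ca : before q c a.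
  move: (uq); rewrite qE E cat_uniq => /and3P[_ /hasPn dis _].
  rewrite /before !index_cat (negPf (dis _ aCs)) (negPf (dis c _)) ?inE ?eqxx //=.
  by rewrite eqxx eq_sym (negPf ac); lia.
have /orP[lt|lt] := pm_lt_total ac.
  exact: inverted_trans (least _ vub _ _ qa qc lt ca) cv.
have nca : ~~ inv_st c a.
  by apply/negP => /(up _ _ qc qa); rewrite (before_asym ca).
apply: (upper_of vub); move: nca cH; rewrite /inv_st /inverted lt negb_or /=.
rewrite !pm_lt_pos -?memq //= => /andP[ns nt].
(* Whichever of s and t puts c after pos k puts a after c, hence after pos k. *)
have gen (u : {perm pm n}) : ~~ pm_lt (u^-1 a) (u^-1 c) ->
    pm_lt (u^-1 (pos k)) (u^-1 c) -> pm_lt (u^-1 (pos k)) (u^-1 a).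
  move=> nac kc; apply: (pm_lt_trans kc).
  have := @pm_lt_total _ (u^-1 a) (u^-1 c).
  by rewrite (inj_eq perm_inj) ac (negPf nac); apply.
by case/orP => [/(gen _ ns) ->|/(gen _ nt) ->]; rewrite ?orbT.
Qed.

Lemma inverted_neg_pos u k : u \in SB n ->
  inverted u (neg k) (pos k) = (u^-1 (pos k)).1.
Proof.
move=> uB; rewrite /inverted -opp_pos SBV_opp // !pm_ltE /=.
by case: (u^-1 _) => [[] l].
Qed.

(** If pos k lies in the negative half of u, then of any two opposite letters the one
in the positive half follows it. *)
Lemma suffix_size u k Cs : u \in SB n -> (u^-1 (pos k)).1 ->
  (forall a, a.2 < k -> inverted u a (pos k) -> a \in Cs) -> k <= size Cs.
Proof.
move=> uB uk sub; rewrite -(size_iota 0 k) -(size_map (fun a => val a.2) Cs).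
apply: uniq_leq_size (iota_uniq 0 k) _ => j; rewrite mem_iota add0n /= => jk.
have jn := ltn_trans jk (ltn_ord k).
have [x [xj xC]] : exists x, x.2 = Ordinal jn /\ x \in Cs.
  have inverted_x (x : pm n) : x.2 = Ordinal jn -> ~~ (u^-1 x).1 -> inverted u x (pos k).
    move=> xj ux; rewrite /inverted pm_lt_pos ?xj // pm_ltE uk.
    by rewrite (negPf ux).
  have [un|up] := boolP (u^-1 (pos (Ordinal jn))).1.
    exists (neg (Ordinal jn)); split=> //; apply: sub => //; apply: inverted_x => //.
    by rewrite -opp_pos SBV_opp //= un.
  by exists (pos (Ordinal jn)); split=> //; apply: sub => //; apply: inverted_x.
by apply/mapP; exists x; rewrite ?xj.
Qed.

(** The letters of Cs have at most k distinct absolute values. *)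
Lemma exists_opposite k Cs : uniq Cs -> (forall a, a \in Cs -> a.2 < k) ->
  k < size Cs -> exists2 a, a \in Cs & opp a \in Cs.
Proof.
move=> uC lt_k lt; apply/hasP; rewrite -[has _ _]negbK -all_predC.
apply/negP => /allP /= no; move: lt; rewrite ltnNge -(size_iota 0 k).
rewrite -(size_map (fun a => val a.2) Cs) uniq_leq_size //.
  rewrite map_inj_in_uniq // => a b aC bC /= /val_inj ab.
  have := no _ aC; case: a b ab aC bC {no} => [r l] [r' l'] /= -> _ bC.
  rewrite /opp /=; have [->//|] := eqVneq r r'.
  by case: r r' bC => [] [] // ->.
by move=> _ /mapP[a /lt_k ak ->]; rewrite mem_iota.
Qed.

Lemma inverted_both u x k : u \in SB n ->
  inverted u x (pos k) -> inverted u (opp x) (pos k) ->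
  inverted u (neg k) (pos k).
Proof.
move=> uB /andP[_ ux] /andP[_ uox]; rewrite inverted_neg_pos //.
move: ux uox; rewrite SBV_opp // !pm_ltE /=.
by case: (u^-1 (pos k)) (u^-1 x) => [[] l] [[] l'].
Qed.

Lemma join_inv_step k q : join_inv k q ->
  exists q', join_step s t (map (@pm_val n) q) k = map (@pm_val n) q' /\
    join_inv k.+1 q'.
Proof.
move=> ji; have [uq sq memq szq up least] := ji.
have [C [Cs [q' [qE sub hd stepE [pq fq sq' bq]]]]] := join_stepP s t uq sq memq szq.
exists q'; split=> //.
have memq' a : (a \in q') = (a.2 < k.+1).
  rewrite (perm_mem pq) !inE memq ltnS [RHS]leq_eqVlt; case: a => b l.
  by rewrite !xpair_eqE -!val_eqE; case: b.
have uq' : uniq q'.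
  by rewrite (perm_uniq pq) /= uq !inE !memq /= ltnn.
have upk a : a \in q -> before q' (pos k) a = (a \in Cs).
  move=> qa; rewrite -(@before_filter _ (predC1 (neg k))) //=; last first.
    by apply: contraTneq qa => ->; rewrite memq ltnn.
  by rewrite fq before_insert -?qE // memq ltnn.
have upold a b : a \in q -> b \in q -> before q' a b = before q a b.
  have Eq : q = filter (predC1 (pos k)) (filter (predC1 (neg k)) q').
    rewrite fq filter_cat /= eqxx /= -filter_cat -qE; apply/esym/all_filterP/allP => x qx.
    by apply: contraTneq qx => ->; rewrite memq ltnn.
  have N x y : x \in q -> y.2 = k -> x != y.
    by move=> + yk; apply: contraTneq => ->; rewrite memq yk ltnn.
  by move=> qa qb; rewrite Eq !before_filter //= ?N.
have qq' a : a \in q -> a \in q' by rewrite memq memq' => /ltnW.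
have pk' : pos k \in q' by rewrite memq'.
have nk' : neg k \in q' by rewrite memq'.
(* By symmetry, a property of the pairs a < b of letters of q' need only be checked
   on the pairs of q, the pairs (a, pos k) and the pair (neg k, pos k). *)
have splitP (R : pm n -> pm n -> Prop) :
    (forall a b, a \in q' -> b \in q' -> R a b -> R (opp b) (opp a)) ->
    (forall a b, a \in q -> b \in q -> pm_lt a b -> R a b) ->
    (forall a, a \in q -> R a (pos k)) -> R (neg k) (pos k) ->
    forall a b, a \in q' -> b \in q' -> pm_lt a b -> R a b.
  move=> Ro Rq Rk Rkk a b; rewrite !(perm_mem pq) !inE.
  have qo x : x \in q -> opp x \in q by rewrite !memq.
  move=> /or3P[/eqP->|/eqP->|qa] /or3P[/eqP->|/eqP->|qb] //; rewrite ?pm_ltxx //.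
  - by rewrite pm_ltE; move: qb; rewrite memq; case: b => [[] l] //=; lia.
  - by move=> _; rewrite -(pm_oppK b) -opp_pos; apply: Ro;
      [exact/qq'/qo | exact: pk' | exact/Rk/qo].
  - by move=> _; apply: Rk.
  - by rewrite pm_ltE; move: qa; rewrite memq; case: a => [[] l] //=; lia.
  - exact: Rq.
have bopp a b : a \in q' -> b \in q' -> before q' (opp b) (opp a) = before q' a b.
  exact: before_mirror.
have uCs : uniq Cs by move: uq; rewrite qE cat_uniq => /and3P[].
have CsP x : x \in Cs -> x.2 < k by move=> xC; rewrite -memq qE mem_cat xC orbT.
split=> //.
- by rewrite (perm_size pq) /= szq.
- move=> a b qa qb st; move: (inv_st_lt st) (st) => {st}; move: a b qa qb.
  apply: (splitP (fun a b => inv_st a b -> before q' b a)) => //.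
  + by move=> x y qx qy h; rewrite inv_st_opp bopp.
  + by move=> x y qx qy _; rewrite upold //; apply: up.
  + by move=> x qx; rewrite upk //; apply: sub; rewrite -memq.
  + rewrite bq => kk; rewrite orbC eq_sym.
    have [neg_st le] : ~~ (~~ (s^-1 (pos k)).1 && ~~ (t^-1 (pos k)).1) /\
        k <= size Cs.
      rewrite negb_and !negbK; move: kk; rewrite /inv_st !inverted_neg_pos // => kk.
      split=> //; case/orP: kk => uk;
        [apply: (suffix_size sB uk) | apply: (suffix_size tB uk)];
        by move=> x xk xu; apply: sub; rewrite // xu ?orbT.
    by rewrite neg_st andbT -leq_eqVlt.
- move=> v vub a b qa qb; move: a b qa qb.
  apply: (splitP (fun a b => before q' b a -> inverted v a b)) => //.
  + by move=> x y qx qy h; rewrite inverted_opp ?bopp //; case: vub.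
  + by move=> x y qx qy xy; rewrite upold //; apply: least.
  + by move=> x qx; rewrite upk // => xC; apply: (suffix_upper ji qE hd vub xC).
  + rewrite bq => /orP[lt|/andP[_]].
      have [x xC oxC] := exists_opposite uCs CsP lt.
      have xv := suffix_upper ji qE hd vub xC.
      have oxv := suffix_upper ji qE hd vub oxC.
      exact: inverted_both (proj1 vub) xv oxv.
    rewrite negb_and !negbK => /orP[] neg_k; apply: (upper_of vub);
      by rewrite /inv_st !inverted_neg_pos // neg_k ?orbT.
Qed.

End Invariant.

Lemma join_string_inv n (s t : {perm pm n}) : s \in SB n -> t \in SB n ->
  exists q, join_string s t = map (@pm_val n) q /\ join_inv s t n q.
Proof.
move=> sB tB.
suff steps m : m <= n -> exists q,
    foldl (join_step s t) [::] (take m (enum 'I_n)) = map (@pm_val n) q /\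
    join_inv s t m q.
  by have := steps n (leqnn n); rewrite take_oversize ?size_enum_ord.
elim: m => [|m IH] lt_m; first by exists [::]; rewrite take0; do 2?split.
have [q [Eq Iq]] := IH (ltnW lt_m).
have [q' [Eq' Iq']] := join_inv_step (k := Ordinal lt_m) sB tB Iq.
exists q'; split=> //.
rewrite (take_nth (Ordinal lt_m)) ?size_enum_ord // foldl_rcons Eq -Eq'.
rewrite (_ : nth _ _ _ = Ordinal lt_m) //.
exact: (nth_ord_enum (Ordinal lt_m) (Ordinal lt_m)).
Qed.

(** * The signed permutation spelled by a symmetric string *)
Section OfString.
Variable n : nat.
Implicit Types (x y a b : pm n) (q : seq (pm n)).

(** The positions -n, .., -1, 1, .., n of the complete notation. *)
Definition positions : seq (pm n) :=
  map (@neg n) (rev (enum 'I_n)) ++ map (@pos n) (enum 'I_n).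

Lemma mem_positions x : x \in positions.
Proof.
rewrite mem_cat; apply/orP; case: x => [[] k]; [left|right].
  by rewrite -[(true, k)]/(neg k) map_f // mem_rev mem_enum.
by rewrite -[(false, k)]/(pos k) map_f // mem_enum.
Qed.

Lemma mirror_positions : mirror positions = positions.
Proof.
rewrite mirror_cat /mirror /positions; move: (enum _) => e.
by rewrite -!map_rev revK -!map_comp.
Qed.

Lemma size_positions : size positions = n.*2.
Proof.
by rewrite size_cat (size_map (@neg n)) (size_map (@pos n)) size_rev
  size_enum_ord addnn.
Qed.

Lemma positions_uniq : uniq positions.
Proof.
rewrite cat_uniq; apply/and3P; split.
- by rewrite map_inj_uniq ?rev_uniq ?enum_uniq // => k l [].
- by apply/hasPn => x /mapP[k _ ->]; apply/mapP => -[].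
- by rewrite map_inj_uniq ?enum_uniq // => k l [].
Qed.

Lemma positions_sorted : sorted (@pm_lt n) positions.
Proof.
have st: sorted (fun k l : 'I_n => k < l) (enum 'I_n).
  by have := iota_ltn_sorted 0 n; rewrite -val_enum_ord sorted_map.
have sp (k l : 'I_n) : pm_lt (pos k) (pos l) = (k < l) by rewrite pm_ltE.
have sn (k l : 'I_n) : pm_lt (neg k) (neg l) = (l < k) by rewrite pm_ltE.
rewrite sorted_pairwise; last exact: pm_lt_trans.
rewrite pairwise_cat -!sorted_pairwise; try exact: pm_lt_trans.
apply/and3P; split.
- by apply/allrelP => x y /mapP[k _ ->] /mapP[l _ ->]; rewrite pm_ltE.
- rewrite sorted_map rev_sorted; apply: sub_sorted st => k l; by rewrite /= sn.
- by rewrite sorted_map; apply: sub_sorted st => k l; rewrite /= sp.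
Qed.

Lemma before_positions x y : before positions x y = pm_lt x y.
Proof.
rewrite /before; have [->|xy] := eqVneq x y; first by rewrite ltnn pm_ltxx.
have lt := sorted_ltn_index (@pm_lt_trans n) positions_sorted.
apply/idP/idP => [/lt|xy']; first by apply; apply: mem_positions.
have := before_total (mem_positions x) xy; rewrite /before => /orP[//|/lt].
by move=> /(_ (mem_positions _) (mem_positions _)); rewrite (pm_lt_asym xy').
Qed.

Variable q : seq (pm n).
Hypotheses (q_uniq : uniq q) (q_mirror : mirror q = q) (q_size : size q = n.*2).

(** The letter of q at position x; the default value is never used. *)
Definition spell x : pm n := nth x q (index x positions).

Lemma index_positions x : index x positions < size q.
Proof. by rewrite q_size -size_positions index_mem mem_positions. Qed.

Lemma spell_inj : injective spell.
Proof.
move=> x y; rewrite /spell (set_nth_default y) ?index_positions // => /eqP.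
rewrite nth_uniq ?index_positions // => /eqP E.
by rewrite -(nth_index x (mem_positions x)) E nth_index ?mem_positions.
Qed.

Lemma map_spell : map spell positions = q.
Proof.
case E : positions => [|x0 r]; rewrite -E.
  by rewrite E /=; apply/esym/nilP; rewrite /nilp q_size -size_positions E.
apply: (@eq_from_nth _ x0); first by rewrite size_map q_size size_positions.
move=> i; rewrite size_map => lt_i; rewrite (nth_map x0) // /spell.
rewrite index_uniq ?positions_uniq //; apply: set_nth_default.
by rewrite q_size -size_positions.
Qed.

(** The permutation whose complete notation is q. *)
Definition perm_of_string : {perm pm n} := perm spell_inj.

Lemma complete_perm_of_string : complete perm_of_string = map (@pm_val n) q.
Proof.
rewrite -map_spell /complete !map_cat -!map_comp; congr (_ ++ _);
  by apply: eq_map => k /=; rewrite permE.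
Qed.

Lemma perm_of_string_SB : perm_of_string \in SB n.
Proof.
apply/SBP => x; rewrite !permE.
have E : map (spell \o @opp n) positions = map (@opp n \o spell) positions.
  rewrite !map_comp map_spell -[map _ positions]revK -/(mirror positions).
  by rewrite mirror_positions map_rev map_spell -{1}q_mirror /mirror revK.
have /eq_in_map := E; apply; exact: mem_positions.
Qed.

Lemma inverted_perm_of_string a b :
  inverted perm_of_string a b = pm_lt a b && before q b a.
Proof.
rewrite /inverted; congr (_ && _).
have sp x : spell (perm_of_string^-1 x) = x.
  by rewrite -[LHS](permE spell_inj) permKV.
have -> : before q b a = before (map spell positions) (spell (perm_of_string^-1 b))
    (spell (perm_of_string^-1 a)) by rewrite map_spell !sp.
rewrite before_map ?before_positions //; exact: spell_inj.
Qed.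

End OfString.

Theorem theorem13 (n : nat) (n_ge1 : 1 <= n) (sigma tau : {perm pm n})
    (sigmaB : sigma \in SB n) (tauB : tau \in SB n) :
  exists J : {perm pm n},
    [/\ J \in SB n, complete J = join_string sigma tau
      & is_joinR sigma tau J].
Proof.
have [q [Eq [uq mq memq szq up least]]] := join_string_inv sigmaB tauB.
have JB := perm_of_string_SB uq mq szq.
have Jinv := inverted_perm_of_string uq szq.
have qT x : x \in q by rewrite memq.
exists (perm_of_string uq szq); split=> //.
  by rewrite Eq complete_perm_of_string.
split=> //; try by apply/leRP => // a b ab;
  rewrite Jinv up /inv_st ?ab ?orbT ?andbT //; case/andP: ab.
move=> v vB /leRP-/(_ sigmaB vB) sv /leRP-/(_ tauB vB) tv; apply/leRP => // a b.
rewrite Jinv => /andP[ab ba]; apply: least => //; split=> // c d /orP[].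
- exact: sv.
- exact: tv.
Qed.
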